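(* Let $\pi_j:A_j\to\mathbb{R}^n$ ($j=1,2$) be unramified real domains over $\mathbb{R}^n$, and let $\mathfrak D=A_1+iA_2$ be the generalized tube, i.e. the domain $A_1\times A_2$ over $\mathbb{C}^n$ with projection $\pi(x+iy)=\pi_1(x)+i\pi_2(y)$. If $\mathfrak D$ is pseudoconvex, then both $\pi_1$ and $\pi_2$ are injective, and $\pi_1(A_1)$, $\pi_2(A_2)$ are convex subdomains of $\mathbb{R}^n$.
   Context: An unramified real domain over $\mathbb{R}^n$ is a connected Hausdorff space $A$ with a local homeomorphism $\pi_A:A\to\mathbb{R}^n$; it is univalent if $\pi_A$ is injective. A domain over $\mathbb{C}^n$ is a connected Hausdorff space $\mathfrak D$ with a local homeomorphism $\pi:\mathfrak D\to\mathbb{C}^n$, with the induced complex structure. For $\zeta\in\mathfrak D$, the boundary distance $\delta(\zeta,\partial\mathfrak D)$ is the supremum of $r>0$ such that the connected component of $\pi^{-1}(B(\pi(\zeta);r))$ containing $\zeta$ is mapped biholomorphically onto the Euclidean ball $B(\pi(\zeta);r)$ by $\pi$. $\mathfrak D$ is pseudoconvex if $-\log\delta(\zeta,\partial\mathfrak D)$ is a (continuous) plurisubharmonic function on $\mathfrak D$ (by Oka's theorem this holds in particular for domains of holomorphy). *)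

(* Defs.v *)
From HB Require Import structures.
From mathcomp Require Import all_boot all_order all_algebra.
From mathcomp Require Import all_classical all_reals all_analysis.
Set Implicit Arguments. Unset Strict Implicit. Unset Printing Implicit Defensive.
Import Order.TTheory GRing.Theory Num.Theory.
Import numFieldNormedType.Exports.
Local Open Scope classical_set_scope.
Local Open Scope ring_scope.

(* R^n is 'rV[R]_n (with its product topology = Euclidean topology).
   C^n is modelled as R^n * R^n : z = (Re z, Im z). *)
Definition Cn (R : realType) (n : nat) := ('rV[R]_n * 'rV[R]_n)%type.

(* local homeomorphism: continuous, and every point has an open
   neighbourhood on which f is injective and open (hence a homeomorphism
   onto an open subset). *)
Definition local_homeo (T U : topologicalType) (f : T -> U) :=
  continuous f /\
  forall x, exists W : set T, [/\ open W, W x, {in W &, injective f} &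
    forall V : set T, open V -> V `<=` W -> open (f @` V)].

Definition unramified_real_domain (R : realType) (n : nat)
    (A : topologicalType) (p : A -> 'rV[R]_n) :=
  [/\ hausdorff_space A, connected [set: A], [set: A] !=set0 & local_homeo p].

Definition domain_over_Cn (R : realType) (n : nat)
    (D : topologicalType) (p : D -> Cn R n) :=
  [/\ hausdorff_space D, connected [set: D], [set: D] !=set0 & local_homeo p].

Definition eucl2 (R : realType) (n : nat) (z : Cn R n) : R :=
  \sum_(i < n) (z.1 ord0 i ^+ 2 + z.2 ord0 i ^+ 2).

Definition Cball (R : realType) (n : nat) (c : Cn R n) (r : R) : set (Cn R n) :=
  [set z | eucl2 (z.1 - c.1, z.2 - c.2) < r ^+ 2].

(* complex affine line: a + (cos t + i sin t) b *)
Definition circ_pt (R : realType) (n : nat) (a b : Cn R n) (t : R) : Cn R n :=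
  (a.1 + (cos t *: b.1 - sin t *: b.2), a.2 + (sin t *: b.1 + cos t *: b.2)).

(* a + l b, with l = (l1 + i l2) *)
Definition line_pt (R : realType) (n : nat) (a b : Cn R n) (l1 l2 : R) : Cn R n :=
  (a.1 + (l1 *: b.1 - l2 *: b.2), a.2 + (l2 *: b.1 + l1 *: b.2)).

(* boundary distance delta(zeta, bd D): supremum of r > 0 such that the
   connected component of p^-1(B(p zeta; r)) containing zeta is mapped by p
   bijectively onto B(p zeta; r) (since p is a local homeomorphism inducing
   the complex structure, this is the same as biholomorphically). *)
Definition bdist (R : realType) (n : nat) (D : topologicalType)
    (p : D -> Cn R n) (zeta : D) : \bar R :=
  ereal_sup [set r%:E | r in [set r : R | 0 < r /\
     let C := connected_component (p @^-1` Cball (p zeta) r) zeta in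
     {in C &, injective p} /\ p @` C = Cball (p zeta) r]].

Definition neglog_bdist (R : realType) (n : nat) (D : topologicalType)
    (p : D -> Cn R n) (zeta : D) : \bar R :=
  match bdist p zeta with
  | r%:E => (- ln r)%:E
  | +oo%E => -oo%E
  | -oo%E => +oo%E
  end.

(* u : D -> [-oo, +oo) plurisubharmonic on the domain D over C^n:
   upper semicontinuous, never +oo, and for every open U on which p is
   injective, u o (p|_U)^-1 satisfies the sub-mean value inequality on
   every closed complex disc {a + l b : |l| <= 1} contained in p(U). *)
Definition plurisubharmonic (R : realType) (n : nat) (D : topologicalType)
    (p : D -> Cn R n) (u : D -> \bar R) :=
  (forall z, u z != +oo%E) /\
  (forall z (c : R), u z < c%:E -> \forall w \near z, u w < c%:E)%E /\
  forall (U : set D) (zeta : D) (b : Cn R n) (g : R -> D),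
    open U -> {in U &, injective p} -> U zeta ->
    (forall l1 l2 : R, l1 ^+ 2 + l2 ^+ 2 <= 1 ->
        (p @` U) (line_pt (p zeta) b l1 l2)) ->
    (forall t, U (g t) /\ p (g t) = circ_pt (p zeta) b t) ->
    (u zeta <= ((2 * pi)^-1)%R%:E *
       \int[@lebesgue_measure R]_(t in `[0%R, (2 * pi)%R]) u (g t))%E.

Definition pseudoconvex (R : realType) (n : nat) (D : topologicalType)
    (p : D -> Cn R n) :=
  continuous (neglog_bdist p) /\ plurisubharmonic p (neglog_bdist p).

Definition tube_proj (R : realType) (n : nat) (A1 A2 : topologicalType)
    (p1 : A1 -> 'rV[R]_n) (p2 : A2 -> 'rV[R]_n) : (A1 * A2)%type -> Cn R n :=
  fun xy => (p1 xy.1, p2 xy.2).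

(* Main.v *)
(** Write [delta_j] for the boundary distance of [A_j].  The boundary distance of
    the tube is [min (delta_1 x) (delta_2 y)], because a ball around [(x, y)]
    lifts to the tube exactly when the two real balls of the same radius lift to
    [A_1] and [A_2].  Fix [y0]: where [delta_1 x] is smaller than [delta_2] near
    [y0], the plurisubharmonic function [- log delta] does not depend on the
    imaginary part, so along real segments it is convex in [x] and obeys the
    maximum principle.  Hence, while the endpoint of a segment lifted from
    [x0] moves in [A_1], [delta_1] stays bounded below along the whole lift, and
    the set of endpoints of such lifts is open and closed: any two points of
    [A_1] are joined by the lift of a segment.  A constant segment only has
    constant lifts, so [p1] is injective, and its image is convex.  Multiplication
    by [i] exchanges the roles of [A_1] and [A_2]. *)
Require Import Defs.
From HB Require Import structures.
From mathcomp Require Import all_boot all_order all_algebra.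
From mathcomp Require Import all_classical all_reals all_analysis.
From mathcomp Require Import ring lra.
Import Order.TTheory GRing.Theory Num.Theory.
Import numFieldNormedType.Exports.
Local Open Scope classical_set_scope.
Local Open Scope ring_scope.
Set Implicit Arguments. Unset Strict Implicit. Unset Printing Implicit Defensive.

(** * Unique lifting and continuous sections *)

(** The coincidence set is open because [f] is locally injective, and closed because [T] is
    Hausdorff. The open set [O] around [K] lets all neighbourhoods be taken in [X]. *)
Lemma lift_unique (X T V : topologicalType) (f : T -> V) (O K : set X)
    (a b : X -> T) (x0 : X) :
  hausdorff_space T -> local_homeo f -> open O -> K `<=` O -> connected K ->
  (forall x, O x -> {for x, continuous a}) ->
  (forall x, O x -> {for x, continuous b}) ->
  (forall x, O x -> f (a x) = f (b x)) ->
  K x0 -> a x0 = b x0 -> forall x, K x -> a x = b x.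
Proof.
move=> hT [_ hf] oO KO cK ca cb fab Kx0 ab0.
have loc x : K x -> a x = b x -> \forall y \near x, a y = b y.
  move=> Kx abx; have [W [oW Wax injW _]] := hf (a x).
  have Wa : \forall y \near x, W (a y).
    by apply: (ca _ (KO _ Kx)); exact: open_nbhs_nbhs.
  have Wb : \forall y \near x, W (b y).
    apply: (cb _ (KO _ Kx)); rewrite -abx; exact: open_nbhs_nbhs.
  have Oy : \forall y \near x, O y by apply: open_nbhs_nbhs; split => //; exact: KO.
  near=> y; apply: injW; rewrite ?inE; [near: y; exact: Wa|near: y; exact: Wb|].
  by apply: fab; near: y.
pose B := K `&` interior [set x | a x = b x].
suff BK : B = K by move=> x; rewrite -BK => -[_ /interior_subset].
apply: cK.
- by exists x0; split => //; exact: loc.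
- by exists (interior [set x | a x = b x]) => //; exact: open_interior.
- exists (closure B); first exact: closed_closure.
  apply/seteqP; split=> [x Bx|x [Kx clx]].
    by split; [case: Bx|exact: subset_closure].
  split => //; apply: loc => //; apply: hT => P Q nP nQ.
  have Pa : \forall y \near x, P (a y) by exact: (ca _ (KO _ Kx)).
  have Qb : \forall y \near x, Q (b y) by exact: (cb _ (KO _ Kx)).
  have [y [[_ /interior_subset/= aby] [Py Qy]]] := clx _ (filterI Pa Qb).
  by exists (a y); split => //; rewrite aby.
Unshelve. all: by end_near.
Qed.

(* [s] is a continuous section of [f] over [B] through [x]; its values outside
   of [B] are irrelevant. *)
Definition lsection (T V : topologicalType) (f : T -> V) (B : set V) (x : T)
    (s : V -> T) :=
  [/\ s (f x) = x, forall v, B v -> f (s v) = v &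
      forall v, B v -> {for v, continuous s}].

(** Near a point [z] of this set, [y] and [s (f y)] both lie where [f] is injective, and they have
    the same projection. *)
Lemma lsection_image_open (T V : topologicalType) (f : T -> V) (B : set V)
    (x : T) (s : V -> T) :
  local_homeo f -> open B -> lsection f B x s ->
  open [set z | B (f z) /\ s (f z) = z].
Proof.
move=> [cf hf] oB [_ fs cs]; rewrite openE => z [Bz sz].
have [W [oW Wz injW _]] := hf z.
have W1 : \forall y \near z, W y by exact: open_nbhs_nbhs.
have B1 : \forall y \near z, B (f y) by apply: cf; exact: open_nbhs_nbhs.
have W2 : \forall y \near z, W (s (f y)).
  have : {for z, continuous (s \o f)} by apply: continuous_comp; [exact: cf|exact: cs].
  by apply; rewrite /= sz; exact: open_nbhs_nbhs.
rewrite /interior; near=> y.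
have By : B (f y) by near: y.
split=> //; apply: injW; rewrite ?inE; [by near: y|by near: y|exact: fs].
Unshelve. all: by end_near.
Qed.

(** On the component, [s \o f] and the identity are two lifts of [f] agreeing at [x]; conversely the
    image of [B] under [s] is connected and contains [x]. *)
Lemma component_lsection (T V : topologicalType) (f : T -> V) (B : set V)
    (x : T) (s : V -> T) :
  hausdorff_space T -> local_homeo f -> open B -> connected B -> B (f x) ->
  lsection f B x s ->
  connected_component (f @^-1` B) x = [set z | B (f z) /\ s (f z) = z].
Proof.
move=> hT hf oB cB Bx [sx fs cs]; apply/seteqP; split=> z.
  move=> Cz; have Bz : B (f z) by exact: (connected_component_sub Cz).
  split => //.
  apply: (@lift_unique T T V f (f @^-1` B) (connected_component (f @^-1` B) x)
    (s \o f) id x) => //.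
  - by apply: open_comp => // t _; exact: hf.1.
  - exact: connected_component_sub.
  - exact: component_connected.
  - by move=> t Bt; apply: continuous_comp; [exact: hf.1|exact: cs].
  - by move=> t _; exact: cvg_id.
  - by move=> t Bt /=; exact: fs.
  - exact: connected_component_refl.
move=> [Bz sz].
apply: (@connected_component_max _ _ (s @` B)).
- by exists (f x).
- by move=> _ [v Bv <-] /=; rewrite fs.
- apply: connected_continuous_connected => //.
  by apply: continuous_in_subspaceT => v; rewrite inE; exact: cs.
- by exists (f z).
Qed.

Lemma local_lsection (T V : topologicalType) (f : T -> V) (x : T) :
  local_homeo f ->
  exists O s, [/\ open O, O (f x) & lsection f O x s].
Proof.
move=> [cf hf]; have [W [oW Wx injW opW]] := hf x.
(* Outside the image of [W] the value is the default [x]. *)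
pose s v := xget x [set z | W z /\ f z = v].
have sE z : W z -> s (f z) = z.
  move=> Wz; have [] := @xgetPex _ x [set y | W y /\ f y = f z] (ex_intro _ z (conj Wz erefl)).
  by move=> Ws fs; apply: injW; rewrite ?inE.
exists (f @` W), s; split; [exact: opW|by exists x|split].
- exact: sE.
- by move=> _ [z Wz <-]; rewrite sE.
- move=> _ [z Wz <-] N /=; rewrite sE//= => Nz.
  have : nbhs (f z) (f @` (W `&` interior N)).
    apply: open_nbhs_nbhs; split; last by exists z.
    by apply: opW; [apply: openI => //; exact: open_interior|exact: subIsetl].
  apply: filterS => _ [t [Wt Nt] <-] /=.
  by rewrite /preimage/= sE//; exact: interior_subset.
Qed.

Definition segment_closed (R : realType) (V : normedModType R) (K : set V) :=
  forall x y (t : R), K x -> K y -> 0 <= t <= 1 -> K (x + t *: (y - x)).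

Lemma segment_closed_connected (R : realType) (V : normedModType R) (K : set V) :
  segment_closed K -> connected K.
Proof.
move=> cK; have [[x Kx]|/set0P/negP/negPn/eqP->] := pselect (K !=set0); last first.
  exact: connected0.
have -> : K = \bigcup_(y in K) ((fun t : R => x + t *: (y - x)) @` `[0, 1]).
  apply/seteqP; split=> [y Ky|_ [y Ky [t /= t01 <-]]].
    by exists y => //; exists 1; rewrite /= ?in_itv/= ?lexx ?ler01// scale1r addrC subrK.
  by apply: cK; rewrite // -in_itv.
apply: bigcup_connected.
  by exists x => y Ky; exists 0; rewrite /= ?in_itv/= ?lexx ?ler01// scale0r addr0.
move=> y Ky; apply: connected_continuous_connected; first exact: segment_connected.
apply: continuous_subspaceT => t.
by apply: cvgD; [exact: cvg_cst|apply: cvgZr_tmp; exact: cvg_id].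
Qed.

Lemma segment_closed_ball (R : realType) (V : normedModType R) (v : V) (e : R) :
  segment_closed (ball v e).
Proof.
move=> x y t; rewrite -ball_normE /= => xe ye /andP[t0 t1].
have -> : v - (x + t *: (y - x)) = (1 - t) *: (v - x) + t *: (v - y).
  have -> : y - x = (v - x) - (v - y) by rewrite opprB [RHS]addrC addrA subrK.
  by rewrite opprD addrA scalerBl scale1r [in LHS]scalerBr opprB addrCA addrC.
rewrite (le_lt_trans (ler_normD _ _))// !normrZ !ger0_norm ?subr_ge0//.
have [->|t0'] := eqVneq t 0; first by rewrite subr0 mul1r mul0r addr0.
have {}t0 : 0 < t by rewrite lt_neqAle eq_sym t0'.
have h1 : t * `|v - y| < t * e by rewrite ltr_pM2l.
have h2 : (1 - t) * `|v - x| <= (1 - t) * e by apply: ler_wpM2l; [lra|exact: ltW].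
lra.
Qed.

(** Turns the condition on components in [bdist] into a continuous section, the form in which balls
    are lifted below. *)
Lemma lsection_of_component (R : realType) (V : normedModType R)
    (T : topologicalType) (f : T -> V) (B : set V) (x : T) :
  local_homeo f -> open B -> B (f x) ->
  {in connected_component (f @^-1` B) x &, injective f} ->
  f @` connected_component (f @^-1` B) x = B ->
  exists s, lsection f B x s.
Proof.
set C := connected_component _ _ => hf oB Bx injf fC.
pose s v := xget x [set z | C z /\ f z = v].
have sP v : B v -> C (s v) /\ f (s v) = v.
  rewrite -fC => -[z Cz fz].
  exact: (@xgetPex _ x [set z | C z /\ f z = v] (ex_intro _ z (conj Cz fz))).
have sE z : C z -> s (f z) = z.
  move=> Cz; have [|Cs fs] := sP (f z); first by rewrite -fC; exists z.
  by apply: injf; rewrite ?inE.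
exists s; split; first exact/sE/connected_component_refl.
  by move=> v /sP[].
move=> v Bv; have [Csv fsv] := sP v Bv.
have [Q [l [oQ Qv [lsv fl cl]]]] := local_lsection (s v) hf.
rewrite fsv in Qv lsv.
have /nbhs_ballP[e /= e0 ballQB] : nbhs v (Q `&` B).
  by apply: open_nbhs_nbhs; split => //; exact: openI.
(* The lift of a small ball by the local section [l] through [s v] is connected, so it stays in [C];
   injectivity on [C] then gives [l = s] near [v]. *)
have tC : l @` ball v e `<=` C.
  rewrite (_ : C = connected_component (f @^-1` B) (s v)); last first.
    exact: same_connected_component.
  apply: connected_component_max.
  - by exists v => //; exact: ballxx.
  - by move=> _ [w /ballQB[Qw Bw] <-] /=; rewrite fl.
  - apply: connected_continuous_connected; last first.
      apply: continuous_in_subspaceT => w; rewrite inE => /ballQB[Qw _].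
      exact: cl.
    exact/segment_closed_connected/segment_closed_ball.
have st : \forall w \near v, l w = s w.
  near=> w; have bw : ball v e w by near: w; exact: nbhsx_ballx.
  have [Qw Bw] := ballQB _ bw.
  by rewrite -[w in RHS]fl// sE//; apply: tC; exists w.
rewrite /prop_for /continuous_at -lsv.
apply: cvg_trans (cl _ Qv); exact: near_eq_cvg.
Unshelve. all: by end_near.
Qed.

(** * Euclidean balls *)

(** The norm of ['rV[R]_n] is the maximum norm, so Euclidean balls are written with the squared
    Euclidean length. *)
Definition sqn (R : realType) (n : nat) (v : 'rV[R]_n) : R :=
  \sum_(i < n) v ord0 i ^+ 2.

Definition Rball (R : realType) (n : nat) (c : 'rV[R]_n) (r : R) :=
  [set z | sqn (z - c) < r ^+ 2].

Lemma eucl2E (R : realType) (n : nat) (z : Cn R n) :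
  eucl2 z = sqn z.1 + sqn z.2.
Proof. by rewrite /eucl2 big_split. Qed.

Lemma sqn_ge0 (R : realType) (n : nat) (v : 'rV[R]_n) : 0 <= sqn v.
Proof. by apply: sumr_ge0 => i _; exact: sqr_ge0. Qed.

Lemma sqn0 (R : realType) (n : nat) : sqn (0 : 'rV[R]_n) = 0.
Proof. by apply: big1 => i _; rewrite mxE expr0n. Qed.

Lemma sqnZ (R : realType) (n : nat) (a : R) (v : 'rV[R]_n) :
  sqn (a *: v) = a ^+ 2 * sqn v.
Proof. by rewrite /sqn mulr_sumr; apply: eq_bigr => i _; rewrite mxE exprMn. Qed.

Lemma sqnN (R : realType) (n : nat) (v : 'rV[R]_n) : sqn (- v) = sqn v.
Proof. by rewrite -scaleN1r sqnZ sqrrN expr1n mul1r. Qed.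

(** Stands in for the triangle inequality without square roots: two lengths below [r] give a squared
    length below [(2 * r) ^+ 2]. *)
Lemma sqnD_le (R : realType) (n : nat) (v w : 'rV[R]_n) :
  sqn (v + w) <= 2 * sqn v + 2 * sqn w.
Proof.
rewrite /sqn !mulr_sumr -big_split/=; apply: ler_sum => i _; rewrite !mxE.
have := sqr_ge0 (v ord0 i - w ord0 i); nra.
Qed.

Lemma convex_comb_lt (R : realFieldType) (x y c t : R) :
  0 <= t <= 1 -> x < c -> y < c -> (1 - t) * x + t * y < c.
Proof.
move=> /andP[t0 t1] xc yc; have [xy|/ltW yx] := leP x y.
- by apply: le_lt_trans yc; nra.
- by apply: le_lt_trans xc; nra.
Qed.

(** In each coordinate the two sides differ by [t * (1 - t)] times the square of the difference. *)
Lemma sqn_convex (R : realType) (n : nat) (v w : 'rV[R]_n) (t : R) :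
  0 <= t <= 1 -> sqn (v + t *: (w - v)) <= (1 - t) * sqn v + t * sqn w.
Proof.
move=> /andP[t0 t1].
rewrite /sqn !mulr_sumr -big_split/=; apply: ler_sum => i _; rewrite !mxE.
have := sqr_ge0 (v ord0 i - w ord0 i).
have : 0 <= t * (1 - t) by apply: mulr_ge0 => //; lra.
nra.
Qed.

Lemma continuous_sqn (R : realType) (n : nat) : continuous (@sqn R n).
Proof.
apply: continuous_big; first exact: add_continuous.
by move=> i _ v; apply: (@continuous_comp _ _ _
  (fun v : 'rV[R]_n => v ord0 i) (fun x : R => x ^+ 2));
  [exact: coord_continuous|exact: exprn_continuous].
Qed.

Lemma Rball_center (R : realType) (n : nat) (c : 'rV[R]_n) (r : R) :
  0 < r -> Rball c r c.
Proof. by move=> r0; rewrite /Rball/= subrr sqn0 exprn_gt0. Qed.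

Lemma Rball_le (R : realType) (n : nat) (c : 'rV[R]_n) (r s : R) :
  0 < r -> r <= s -> Rball c r `<=` Rball c s.
Proof.
move=> r0 rs z /lt_le_trans; apply.
by rewrite ler_pXn2r// nnegrE ltW// (lt_le_trans r0).
Qed.

Lemma Rball_half (R : realType) (n : nat) (c d : 'rV[R]_n) (r : R) :
  Rball c r d -> Rball d r `<=` Rball c (2 * r).
Proof.
move=> cd z dz; rewrite /Rball/=.
have := sqnD_le (z - d) (d - c); rewrite addrA subrK.
by move: cd dz; rewrite /Rball/=; nra.
Qed.

Lemma Rball_sym (R : realType) (n : nat) (c d : 'rV[R]_n) (r : R) :
  Rball c r d -> Rball d r c.
Proof. by rewrite /Rball/= -sqnN opprB. Qed.

Lemma open_Rball (R : realType) (n : nat) (c : 'rV[R]_n) (r : R) :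
  open (Rball c r).
Proof.
rewrite (_ : Rball c r = (fun z => sqn (z - c)) @^-1` [set x | x < r ^+ 2])//.
apply: open_comp; last exact: open_lt.
move=> z _; apply: continuous_comp; last exact: continuous_sqn.
exact: (cvgB cvg_id (cvg_cst _)).
Qed.

Lemma segment_closed_Rball (R : realType) (n : nat) (c : 'rV[R]_n) (r : R) :
  segment_closed (Rball c r).
Proof.
move=> x y t xr yr t01; rewrite /Rball/=.
have -> : x + t *: (y - x) - c = (x - c) + t *: ((y - c) - (x - c)).
  by rewrite opprB addrA subrK addrAC.
exact: le_lt_trans (sqn_convex (x - c) (y - c) t01) (convex_comb_lt t01 xr yr).
Qed.

Lemma Cball_center (R : realType) (n : nat) (c : Cn R n) (r : R) :
  0 < r -> Cball c r c.
Proof. by move=> r0; rewrite /Cball/= eucl2E /= !subrr !sqn0 addr0 exprn_gt0. Qed.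

Lemma Cball_sub (R : realType) (n : nat) (c : Cn R n) (r : R) z :
  Cball c r z -> Rball c.1 r z.1 /\ Rball c.2 r z.2.
Proof.
rewrite /Cball/= eucl2E /= /Rball/= => h.
have := sqn_ge0 (z.1 - c.1); have := sqn_ge0 (z.2 - c.2); lra.
Qed.

Lemma open_Cball (R : realType) (n : nat) (c : Cn R n) (r : R) :
  open (Cball c r).
Proof.
rewrite (_ : Cball c r = (fun z : Cn R n => sqn (z.1 - c.1) + sqn (z.2 - c.2))
  @^-1` [set x | x < r ^+ 2]); last first.
  by apply/seteqP; split=> z; rewrite /Cball/= eucl2E.
apply: open_comp; last exact: open_lt.
move=> z _.
apply: cvgD; (apply: continuous_comp; last exact: continuous_sqn).
  by apply: cvgB; [exact: cvg_fst|exact: cvg_cst].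
by apply: cvgB; [exact: cvg_snd|exact: cvg_cst].
Qed.

Lemma segment_closed_Cball (R : realType) (n : nat) (c : Cn R n) (r : R) :
  segment_closed (Cball c r : set ('rV[R]_n * 'rV[R]_n)%type).
Proof.
move=> x y t xr yr t01; rewrite /Cball/= eucl2E /=.
have E (a b d : 'rV[R]_n) : a + t *: (b - a) - d = (a - d) + t *: ((b - d) - (a - d)).
  by rewrite opprB addrA subrK addrAC.
rewrite !E.
have h1 := sqn_convex (x.1 - c.1) (y.1 - c.1) t01.
have h2 := sqn_convex (x.2 - c.2) (y.2 - c.2) t01.
apply: le_lt_trans (lerD h1 h2) _.
move: xr yr; rewrite /Cball/= !eucl2E /= => xr yr.
have := convex_comb_lt t01 xr yr; lra.
Qed.

(** * The boundary distance of the tube *)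

Lemma hausdorff_prod (T U : topologicalType) :
  hausdorff_space T -> hausdorff_space U -> hausdorff_space (T * U)%type.
Proof.
move=> hT hU [a b] [c d] cl.
have nfst (x : T) (y : U) P : nbhs x P -> nbhs (x, y) (fst @^-1` P).
  by exists (P, setT); [split=> //; exact: filterT|move=> [? ?] []].
have nsnd (x : T) (y : U) P : nbhs y P -> nbhs (x, y) (snd @^-1` P).
  by exists (setT, P); [split=> //; exact: filterT|move=> [? ?] []].
congr pair.
- apply: hT => P Q nP nQ.
  by have [[x y] [/= Px Qx]] := cl _ _ (nfst a b P nP) (nfst c d Q nQ); exists x.
- apply: hU => P Q nP nQ.
  by have [[x y] [/= Px Qx]] := cl _ _ (nsnd a b P nP) (nsnd c d Q nQ); exists y.
Qed.

Lemma continuous_pair (X T U : topologicalType) (f : X -> T) (g : X -> U) (x : X) :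
  {for x, continuous f} -> {for x, continuous g} ->
  {for x, continuous (fun z => (f z, g z))}.
Proof.
move=> cf cg N [[P Q] /= [nP nQ] PQN].
near=> z; apply: PQN; split => /=; near: z; [exact: cf|exact: cg].
Unshelve. all: by end_near.
Qed.

Lemma lsection_sub (T V : topologicalType) (f : T -> V) (B B' : set V) (x : T)
    (s : V -> T) :
  B' `<=` B -> lsection f B x s -> lsection f B' x s.
Proof. by move=> BB [sx fs cs]; split => // v /BB; [exact: fs|exact: cs]. Qed.

Section tube.
Variables (R : realType) (n : nat) (A1 A2 : topologicalType).
Variables (p1 : A1 -> 'rV[R]_n) (p2 : A2 -> 'rV[R]_n).

Lemma local_homeo_tube :
  local_homeo p1 -> local_homeo p2 -> local_homeo (tube_proj p1 p2).
Proof.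
move=> [c1 h1] [c2 h2]; split.
  move=> [x y]; apply: continuous_pair.
    by apply: (@continuous_comp _ _ _ fst p1); [exact: cvg_fst|exact: c1].
  by apply: (@continuous_comp _ _ _ snd p2); [exact: cvg_snd|exact: c2].
move=> [x y]; have [W1 [oW1 Wx i1 op1]] := h1 x; have [W2 [oW2 Wy i2 op2]] := h2 y.
exists (W1 `*` W2); split => //.
- by rewrite openE => -[a b] [/= Wa Wb]; exists (W1, W2) => //; split;
    exact: open_nbhs_nbhs.
- move=> [a b] [c d]; rewrite !inE => -[/= Wa Wb] [/= Wc Wd] [ac bd].
  by congr pair; [apply: i1|apply: i2]; rewrite ?inE.
- move=> V oV VW; rewrite openE => _ [[a b] Vab <-].
  have : nbhs (a, b) V by exact: open_nbhs_nbhs.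
  move=> [[P Q] /= [nP nQ] PQV].
  have [Wa Wb] := VW _ Vab; rewrite /= in Wa Wb.
  exists (p1 @` (W1 `&` interior P), p2 @` (W2 `&` interior Q)) => /=.
    split; apply: open_nbhs_nbhs; split.
    + by apply: op1; [apply: openI => //; exact: open_interior|exact: subIsetl].
    + by exists a.
    + by apply: op2; [apply: openI => //; exact: open_interior|exact: subIsetl].
    + by exists b.
  move=> [_ _] [/= [a' [_ /interior_subset Pa] <-] [b' [_ /interior_subset Qb] <-]].
  by exists (a', b') => //; exact: PQV.
Qed.

(** A complex ball lies in the product of the real balls of the same radius. *)
Lemma lsection_tube x y r s1 s2 :
  lsection p1 (Rball (p1 x) r) x s1 -> lsection p2 (Rball (p2 y) r) y s2 ->
  lsection (tube_proj p1 p2) (Cball (p1 x, p2 y) r) (x, y)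
    (fun z => (s1 z.1, s2 z.2)).
Proof.
move=> [sx f1 c1] [sy f2 c2]; split.
- by rewrite /tube_proj/= sx sy.
- by move=> [v w] /Cball_sub[/= Bv Bw]; rewrite /tube_proj/= f1// f2.
- move=> [v w] /Cball_sub[/= Bv Bw]; apply: continuous_pair.
    by apply: (@continuous_comp _ _ _ fst s1); [exact: cvg_fst|exact: c1].
  by apply: (@continuous_comp _ _ _ snd s2); [exact: cvg_snd|exact: c2].
Qed.

(** The slice of a complex ball at the imaginary part of its centre is a real ball of the same
    radius, so no radius is lost. *)
Lemma lsection_tube1 x y r s : 0 < r ->
  lsection (tube_proj p1 p2) (Cball (p1 x, p2 y) r) (x, y) s ->
  lsection p1 (Rball (p1 x) r) x (fun v => (s (v, p2 y)).1).
Proof.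
move=> r0 [sx fs cs].
have BC v : Rball (p1 x) r v -> Cball (p1 x, p2 y) r (v, p2 y).
  by rewrite /Rball/Cball/= eucl2E /= subrr sqn0 addr0.
split.
- by rewrite sx.
- by move=> v /BC/fs; rewrite /tube_proj => -[].
- move=> v /BC/cs csv.
  apply: (@continuous_comp _ _ _ (fun v => s (v, p2 y)) fst); last exact: cvg_fst.
  apply: (@continuous_comp _ _ _ (fun v => (v, p2 y)) s); last exact: csv.
  by apply: continuous_pair; [exact: cvg_id|exact: cst_continuous].
Qed.

Lemma lsection_tube2 x y r s : 0 < r ->
  lsection (tube_proj p1 p2) (Cball (p1 x, p2 y) r) (x, y) s ->
  lsection p2 (Rball (p2 y) r) y (fun v => (s (p1 x, v)).2).
Proof.
move=> r0 [sx fs cs].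
have BC v : Rball (p2 y) r v -> Cball (p1 x, p2 y) r (p1 x, v).
  by rewrite /Rball/Cball/= eucl2E /= subrr sqn0 add0r.
split.
- by rewrite sx.
- by move=> v /BC/fs; rewrite /tube_proj => -[].
- move=> v /BC/cs csv.
  apply: (@continuous_comp _ _ _ (fun v => s (p1 x, v)) snd); last exact: cvg_snd.
  apply: (@continuous_comp _ _ _ (fun v => (p1 x, v)) s); last exact: csv.
  by apply: continuous_pair; [exact: cst_continuous|exact: cvg_id].
Qed.

Hypotheses (h1 : hausdorff_space A1) (h2 : hausdorff_space A2).
Hypotheses (l1 : local_homeo p1) (l2 : local_homeo p2).

(** The component over the complex ball is the image of the product section, which makes [r]
    admissible in the supremum [bdist]. *)
Lemma neglog_bdist_le x y r s1 s2 : 0 < r ->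
  lsection p1 (Rball (p1 x) r) x s1 -> lsection p2 (Rball (p2 y) r) y s2 ->
  (neglog_bdist (tube_proj p1 p2) (x, y) <= (- ln r)%:E)%E.
Proof.
move=> r0 sx sy; have ss := lsection_tube sx sy.
have : (r%:E <= bdist (tube_proj p1 p2) (x, y))%E.
  apply: ereal_sup_ubound; exists r => //; split => //=.
  have hT := hausdorff_prod h1 h2; have lT := local_homeo_tube l1 l2.
  have cB : connected (Cball (tube_proj p1 p2 (x, y)) r : set ('rV[R]_n * 'rV[R]_n)%type).
    exact/segment_closed_connected/segment_closed_Cball.
  have BB : Cball (tube_proj p1 p2 (x, y)) r (tube_proj p1 p2 (x, y)).
    exact: Cball_center.
  rewrite (component_lsection hT lT (@open_Cball _ _ _ _) cB BB ss); split.
    by move=> a b; rewrite !inE => -[Ba {2}<-] [Bb {2}<-] ->.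
  have [_ fs _] := ss.
  apply/seteqP; split=> [_ [z [Bz _] <-]//|v Bv].
  exists (s1 v.1, s2 v.2); last exact: fs.
  by split; rewrite (fs v Bv).
rewrite /neglog_bdist; case: bdist => [d| |]; rewrite ?leNye// !lee_fin lerN2 => rd.
by rewrite ler_ln// posrE// (lt_le_trans r0).
Qed.

(** The supremum may not be attained; the strict bound on [r] leaves room for an admissible [e > r],
    whose section is sliced and restricted. *)
Lemma lsection_of_neglog x y M r :
  (neglog_bdist (tube_proj p1 p2) (x, y) <= M%:E)%E -> 0 < r -> r < expR (- M) ->
  (exists s1, lsection p1 (Rball (p1 x) r) x s1) /\
  (exists s2, lsection p2 (Rball (p2 y) r) y s2).
Proof.
move=> uM r0 rM.
have : (r%:E < bdist (tube_proj p1 p2) (x, y))%E.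
  (* Some positive radius is admissible, so a finite distance [d] is positive and
     [expR (ln d) = d]. *)
  have : (-oo < bdist (tube_proj p1 p2) (x, y))%E.
    by move: uM; rewrite /neglog_bdist; case: bdist => //= d _; rewrite ltNyr.
  move=> /ereal_sup_gt[_ [e [e0 He] _] _].
  have : (e%:E <= bdist (tube_proj p1 p2) (x, y))%E.
    by apply: ereal_sup_ubound; exists e.
  move: uM; rewrite /neglog_bdist; case: bdist => //= [d|]; last by rewrite ltry.
  rewrite !lee_fin lte_fin => dM ed; have d0 : 0 < d by exact: lt_le_trans ed.
  by apply: lt_le_trans rM _; rewrite -[d]lnK ?posrE// ler_expR lerNl.
move=> /ereal_sup_gt[_ [e [e0 [inje ontoe]] <-]]; rewrite lte_fin => re.
have [s ss] := lsection_of_component (local_homeo_tube l1 l2) (@open_Cball _ _ _ _)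
  (Cball_center (tube_proj p1 p2 (x, y)) e0) inje ontoe.
have sub m (c : 'rV[R]_m) : Rball c r `<=` Rball c e by apply: Rball_le => //; exact: ltW.
split; eexists; apply: lsection_sub (sub _ _) _.
  exact: lsection_tube1 e0 ss.
exact: lsection_tube2 e0 ss.
Qed.
End tube.

(** * Means over circles *)

(* The library version [le_integral] asks for integrability, but the integral is
   a supremum over simple functions, which is monotone without it. *)
Lemma le_integral_nonmeasurable d (T : measurableType d) (R : realType)
    (mu : {measure set T -> \bar R}) (D : set T) (f g : T -> \bar R) :
  (forall x, D x -> f x <= g x)%E ->
  (\int[mu]_(x in D) f x <= \int[mu]_(x in D) g x)%E.
Proof.
have ge0_le (h k : T -> \bar R) : (forall x, D x -> 0 <= h x)%E ->
    (forall x, D x -> 0 <= k x)%E -> (forall x, D x -> h x <= k x)%E ->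
    (\int[mu]_(x in D) h x <= \int[mu]_(x in D) k x)%E.
  move=> h0 k0 hk; rewrite !ge0_integralE//.
  apply: ereal_sup_le => _ [s /= sh <-]; exists s => //= x.
  apply: (le_trans (sh x)); rewrite !patchE; case: ifPn => // xD.
  by apply: hk; rewrite inE in xD.
move=> fg; rewrite integralE [leRHS]integralE leeB//; apply: ge0_le => // x Dx.
- by rewrite !funeposE ge_max !le_max lexx orbT andbT fg.
- by rewrite !funenegE ge_max !le_max lexx orbT andbT leeN2 fg.
Qed.

Lemma integral_trig_quadratic (R : realType) (m a b : R) :
  (\int[@lebesgue_measure R]_(t in `[0%R, (2 * pi)%R])
     (m - a * cos t - b * cos t ^+ 2)%R%:E = (2 * pi * (m - b / 2))%R%:E)%E.
Proof.
(* [(t + sin t * cos t) / 2] is a primitive of [cos t ^+ 2]. *)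
pose F (t : R) : R^o := m * t - a * sin t - b / 2 * (t + sin t * cos t).
have dF (t : R) : is_derive t 1 F (m - a * cos t - b * cos t ^+ 2).
  apply: is_derive_eq.
  have s2 : sin t * - sin t = cos t ^+ 2 - 1 by have := cos2Dsin2 t; lra.
  by rewrite /GRing.scale/= s2; field.
have cF : continuous F.
  by move=> t; apply/differentiable_continuous/derivable1_diffP; exact: ex_derive.
have pi0 : 0 < 2 * pi :> R by rewrite mulr_gt0// pi_gt0.
rewrite (@continuous_FTC2 _ _ F) //.
- rewrite -EFinB; congr EFin; rewrite /F mulr_natl sin2pi sin0.
  by field.
- apply: continuous_subspaceT => t.
  by apply: cvgB; [apply: cvgB; [exact: cvg_cst|]|];
    (apply: cvgM; first exact: cvg_cst); [|apply: cvgM]; exact: continuous_cos.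
- split=> [t _| |]; first exact: ex_derive.
    by apply: cvg_at_right_filter; exact: cF.
  by apply: cvg_at_left_filter; exact: cF.
- by move=> t _; rewrite derive1E derive_val.
Qed.

(** The cosine averages to 0 and its square to 1/2. For [b > 0] the bound falls strictly below [m],
    which drives the maximum principle. *)
Lemma circle_mean_le (R : realType) (F : R -> \bar R) (m a b : R) :
  (forall t, F t <= (m - a * cos t - b * cos t ^+ 2)%R%:E)%E ->
  (((2 * pi)^-1)%R%:E * \int[@lebesgue_measure R]_(t in `[0%R, (2 * pi)%R]) F t
    <= (m - b / 2)%R%:E)%E.
Proof.
move=> Fle; have pi0 : 0 < 2 * pi :> R by rewrite mulr_gt0// pi_gt0.
have -> : m - b / 2 = (2 * pi)^-1 * (2 * pi * (m - b / 2)).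
  by rewrite mulrA mulVf ?mul1r// lt0r_neq0.
rewrite EFinM -(integral_trig_quadratic m a b) lee_pmul2l ?lte_fin ?invr_gt0//.
by apply: le_integral_nonmeasurable => t _; exact: Fle.
Qed.

(** * Lifts of segments *)

(** The retraction of the line onto [[0, 1]]: composing with it extends to all times what a path
    satisfies on [[0, 1]]. *)
Definition clamp (R : realType) (t : R) : R := Num.max 0 (Num.min t 1).

Lemma clamp_itv (R : realType) (t : R) : 0 <= clamp t <= 1.
Proof. by rewrite /clamp le_max lexx /= ge_max ler01 ge_min lexx orbT. Qed.

Lemma clamp_id (R : realType) (t : R) : 0 <= t <= 1 -> clamp t = t.
Proof. by move=> /andP[t0 t1]; rewrite /clamp min_l// max_r. Qed.

Lemma clamp_continuous (R : realType) : continuous (@clamp R).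
Proof.
move=> t; apply: (@continuous_comp _ _ _ (fun t : R => (0 : R, Num.min t 1))
  (fun p : R * R => Num.max p.1 p.2)); last exact: max_continuous.
apply: continuous_pair; first exact: cst_continuous.
apply: (@continuous_comp _ _ _ (fun t : R => (t, 1 : R))
  (fun p : R * R => Num.min p.1 p.2)); last exact: min_continuous.
by apply: continuous_pair; [exact: cvg_id|exact: cst_continuous].
Qed.

(** The intersection of two convex sets is connected, so unique lifting applies on it. *)
Lemma lsection_agree (R : realType) (V : normedModType R) (T : topologicalType)
    (f : T -> V) (B B' : set V) (x x' : T) (s s' : V -> T) (v : V) :
  hausdorff_space T -> local_homeo f ->
  open B -> open B' -> segment_closed B -> segment_closed B' ->
  lsection f B x s -> lsection f B' x' s' ->
  B v -> B' v -> s v = s' v -> forall w, B w -> B' w -> s w = s' w.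
Proof.
move=> hT lf oB oB' cB cB' [_ fs cs] [_ fs' cs'] Bv B'v sv w Bw B'w.
apply: (@lift_unique V T V f (B `&` B') (B `&` B') s s' v) => //.
- exact: openI.
- apply: segment_closed_connected => a b t [Ba B'a] [Bb B'b] t01.
  by split; [exact: cB|exact: cB'].
- by move=> z [Bz _]; exact: cs.
- by move=> z [_ Bz]; exact: cs'.
- by move=> z [Bz B'z]; rewrite fs// fs'.
Qed.

Definition segment_lifts (R : realType) (n : nat) (A : topologicalType)
    (p : A -> 'rV[R]_n) (x0 x1 : A) :=
  exists s : R -> A, [/\ continuous s, s 0 = x0, s 1 = x1 &
    forall t, 0 <= t <= 1 -> p (s t) = p x0 + t *: (p x1 - p x0)].

Section lifting.
Variables (R : realType) (n : nat) (A : topologicalType) (p : A -> 'rV[R]_n).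
Hypotheses (hA : hausdorff_space A) (lp : local_homeo p).

Lemma segment_lifts_refl x : segment_lifts p x x.
Proof.
exists (fun=> x); split=> //; first by move=> t; exact: cst_continuous.
by move=> t _; rewrite subrr scaler0 addr0.
Qed.

Lemma Rball_agree c c' r r' (x x' : A) s s' v :
  lsection p (Rball c r) x s -> lsection p (Rball c' r') x' s' ->
  Rball c r v -> Rball c' r' v -> s v = s' v ->
  forall w, Rball c r w -> Rball c' r' w -> s w = s' w.
Proof.
by apply: lsection_agree => //; (exact: open_Rball || exact: segment_closed_Rball).
Qed.

(** At time [t] the new segment is at distance less than [r] from the old one, so the section
    through [s t] carries [s t] to a point above the new segment. The radius [r] has to serve the
    whole lift. *)
Lemma segment_lifts_extend x0 x1 x2 (s : R -> A) (r : R) sg :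
  continuous s -> s 0 = x0 -> s 1 = x1 ->
  (forall t, 0 <= t <= 1 -> p (s t) = p x0 + t *: (p x1 - p x0)) ->
  0 < r ->
  (forall t, 0 <= t <= 1 -> exists f, lsection p (Rball (p (s t)) r) (s t) f) ->
  lsection p (Rball (p x1) r) x1 sg -> Rball (p x1) r (p x2) -> sg (p x2) = x2 ->
  segment_lifts p x0 x2.
Proof.
move=> cs s0 s1 ps r0 secs sgx1 x12 sgx2.
pose sc t := s (clamp t).
have csc : continuous sc.
  by move=> t; apply: continuous_comp; [exact: clamp_continuous|exact: cs].
have /choice[f fP] : forall t, exists g, lsection p (Rball (p (sc t)) r) (sc t) g.
  by move=> t; exact/secs/clamp_itv.
pose q t := p x0 + clamp t *: (p x2 - p x0).
have cq : continuous q.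
  move=> t; apply: cvgD; first exact: cvg_cst.
  by apply: cvgZr_tmp; exact: clamp_continuous.
have qB t : Rball (p (sc t)) r (q t).
  rewrite /Rball/= /q /sc ps; last exact: clamp_itv.
  have -> : p x0 + clamp t *: (p x2 - p x0) - (p x0 + clamp t *: (p x1 - p x0)) =
      clamp t *: (p x2 - p x1).
    rewrite opprD addrACA subrr add0r -scalerBr; congr (_ *: _).
    by rewrite opprB addrA subrK.
  rewrite sqnZ; have /andP[c0 c1] := clamp_itv t.
  move: x12; rewrite /Rball/=; have := sqn_ge0 (p x2 - p x1).
  have : clamp t ^+ 2 <= 1 by rewrite expr_le1.
  have := sqr_ge0 (clamp t); nra.
have sc0 : sc 0 = x0 by rewrite /sc clamp_id ?s0// lexx ler01.
have sc1 : sc 1 = x1 by rewrite /sc clamp_id ?s1// lexx ler01.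
exists (fun t => f t (q t)); split.
- move=> t; have [ft pft cft] := fP t.
  have cont : {for t, continuous (f t \o q)}.
    by apply: continuous_comp; [exact: cq|exact: cft].
  (* The sections [f t] were chosen independently. For [t'] near [t], however, [f t] passes through
     [sc t'], so it agrees with [f t'] on the overlap of their balls, and [t] can be frozen. *)
  have near_eq : \forall t' \near t, (f t \o q) t' = f t' (q t').
    have oN := lsection_image_open lp (@open_Rball _ _ _ _) (fP t).
    have N1 : \forall t' \near t, Rball (p (sc t)) r (p (sc t')) /\
        f t (p (sc t')) = sc t'.
      apply: (csc t [set z | Rball (p (sc t)) r (p z) /\ f t (p z) = z]).
      by apply: open_nbhs_nbhs; split=> //; split=> //; exact: Rball_center.
    have N2 : \forall t' \near t, Rball (p (sc t)) r (q t').
      by apply: (cq t (Rball (p (sc t)) r)); apply: open_nbhs_nbhs; split; [exact: open_Rball|exact: qB].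
    near=> t'; have [Bt' ft'] : Rball (p (sc t)) r (p (sc t')) /\
        f t (p (sc t')) = sc t' by near: t'.
    have Bq : Rball (p (sc t)) r (q t') by near: t'.
    apply: (Rball_agree (fP t) (fP t') Bt' (Rball_center _ r0)) => //.
    by rewrite ft'; case: (fP t').
  rewrite /continuous_at.
  have -> : f t (q t) = (f t \o q) t by [].
  by apply: cvg_trans cont; exact: near_eq_cvg.
- have := fP 0; rewrite sc0 => -[f0 _ _].
  by rewrite /q clamp_id ?lexx ?ler01// scale0r addr0 f0.
- rewrite /q clamp_id ?lexx ?ler01// scale1r addrC subrK.
  have := fP 1; rewrite sc1 => f1; rewrite -[RHS]sgx2.
  apply: (Rball_agree f1 sgx1 (Rball_center _ r0) (Rball_center _ r0) _ x12 x12).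
  by case: f1 => ->; case: sgx1 => ->.
- move=> t t01; have [_ pft _] := fP t.
  by rewrite pft ?qB// /q clamp_id.
Unshelve. all: by end_near.
Qed.

(** The lift and the constant path both project to a single point, so they coincide. *)
Lemma segment_lifts_inj x0 x1 : segment_lifts p x0 x1 -> p x0 = p x1 -> x0 = x1.
Proof.
move=> [s [cs <- <- ps]] p01.
have := @lift_unique R A _ p setT `[0, 1] (s \o @clamp R) (cst (s 0)) 0 hA lp.
move=> /(_ openT _ _ _ _ _ _ _ 1); rewrite /= !clamp_id ?lexx ?ler01// => -> //.
- exact: segment_connected.
- by move=> t _; apply: continuous_comp; [exact: clamp_continuous|exact: cs].
- by move=> t _; exact: cst_continuous.
- by move=> t _; rewrite ps ?clamp_itv// p01 subrr scaler0 addr0.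
- by rewrite in_itv/= lexx ler01.
- by rewrite in_itv/= lexx ler01.
Qed.

Lemma segment_lifts_convex : (forall x0 x1, segment_lifts p x0 x1) ->
  convex_set (p @` setT).
Proof.
move=> sl _ _ t /set_mem[x _ <-] /set_mem[y _ <-]; apply/mem_set.
(* The convex combination puts the weight [t] on [p x], so the segment runs from [y] to [x]. *)
have [s [_ _ _ ps]] := sl y x.
exists (s t%:inum) => //; rewrite ps; last by apply/andP; split.
by rewrite /conv/= /unstable.onem scalerBl scale1r scalerBr addrCA.
Qed.

End lifting.

(** * The maximum principle along lifted segments *)

Lemma fine_maxK (R : realType) (x : \bar R) (M : R) :
  x != +oo%E -> (fine (maxe x M%:E))%:E = maxe x M%:E.
Proof.
move=> xy; rewrite fineK// fin_numE -ltNye -ltey lt_max ltNyr orbT gt_max ltry.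
by rewrite andbT ltey xy.
Qed.

(** Truncation at [M] removes the value [-oo], so that the extreme value theorem for real functions
    applies. *)
Lemma continuous_fine_max (R : realType) (T : topologicalType)
    (f : T -> \bar R) (M : R) :
  continuous f -> (forall x, f x != +oo%E) ->
  continuous (fun x => fine (maxe (f x) M%:E)).
Proof.
move=> cf fy x; apply: fine_cvg; rewrite fine_maxK//.
apply: (@continuous_comp _ _ _ (fun x => (f x, M%:E))
  (fun p : \bar R * \bar R => maxe p.1 p.2)); last exact: max_continuous.
by apply: continuous_pair; [exact: cf|exact: cst_continuous].
Qed.

Section convexity.
Variables (R : realType) (n : nat) (A1 A2 : topologicalType).
Variables (p1 : A1 -> 'rV[R]_n) (p2 : A2 -> 'rV[R]_n).
(* [u] plays the role of [- log delta]; [k] is the orientation of the complex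
   line through a real vector [v], [1] when [v] moves the first factor and [-1]
   when it moves the second one. *)
Variables (u : A1 -> A2 -> \bar R) (k : R).
Hypotheses (hA : hausdorff_space A1) (lp : local_homeo p1).
Hypothesis cA : connected [set: A1].
Hypothesis k1 : k ^+ 2 = 1.
Hypothesis u_cont : forall y, continuous (u^~ y).
Hypothesis u_fin : forall x y, u x y != +oo%E.
Hypothesis u_sections : forall x y (M r : R), (u x y <= M%:E)%E -> 0 < r -> r < expR (- M) ->
  (exists s1, lsection p1 (Rball (p1 x) r) x s1) /\
  (exists s2, lsection p2 (Rball (p2 y) r) y s2).
Hypothesis u_le : forall x y (r : R) (s1 : 'rV[R]_n -> A1) (s2 : 'rV[R]_n -> A2), 0 < r ->
  lsection p1 (Rball (p1 x) r) x s1 -> lsection p2 (Rball (p2 y) r) y s2 ->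
  (u x y <= (- ln r)%:E)%E.
Hypothesis u_mean : forall x y (r : R) (s1 : 'rV[R]_n -> A1) (s2 : 'rV[R]_n -> A2) (v : 'rV[R]_n), 0 < r ->
  lsection p1 (Rball (p1 x) r) x s1 -> lsection p2 (Rball (p2 y) r) y s2 ->
  sqn v < r ^+ 2 ->
  (u x y <= ((2 * pi)^-1)%R%:E *
    \int[@lebesgue_measure R]_(t in `[0%R, (2 * pi)%R])
      u (s1 (p1 x + cos t *: v)%R) (s2 (p2 y + (k * sin t) *: v)%R))%E.

Lemma u_real x y : exists M : R, (u x y <= M%:E)%E.
Proof.
have := u_fin x y; case: (u x y) => [r| |] // _; first by exists r.
by exists 0; rewrite leNye.
Qed.

(* A substitute for [u x y = max (- log delta_1 x) (- log delta_2 y)]: near [y0]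
   the second term is at most [c]. *)
Lemma u_flat (x0 : A1) (y0 : A2) : exists (c r0 : R) (s2 : 'rV[R]_n -> A2), [/\ 0 < r0,
  lsection p2 (Rball (p2 y0) r0) y0 s2 &
  forall (x : A1) (w : 'rV[R]_n) (M : R), Rball (p2 y0) r0 w -> c <= M -> (u x y0 <= M%:E)%E ->
    (u x (s2 w) <= M%:E)%E].
Proof.
have [M0 uM0] := u_real x0 y0.
pose r1 := expR (- M0) / 2; have e0 := expR_gt0 (- M0).
have [_ [s2 sec2]] : (exists s1, lsection p1 (Rball (p1 x0) r1) x0 s1) /\
    (exists s2, lsection p2 (Rball (p2 y0) r1) y0 s2).
  by apply: (u_sections uM0); rewrite /r1; lra.
(* Halving keeps every ball of radius at most [r0] around a point [w] of the [r0]-ball inside the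
   domain of [s2]. *)
pose r0 := r1 / 2; have r00 : 0 < r0 by rewrite /r0 /r1; lra.
have sub01 : Rball (p2 y0) r0 `<=` Rball (p2 y0) r1.
  by apply: Rball_le => //; rewrite /r0 in r00 *; lra.
exists (- ln r0), r0, s2; split => //; first exact: lsection_sub sec2.
move=> x w M wB cM uM; have [_ ps2 cs2] := sec2.
have pw : p2 (s2 w) = w by apply: ps2; exact: sub01.
(* Sections over [A1] are available only for radii strictly below [expR (- M)], hence the slack
   [e]. *)
apply/lee_addgt0Pr => e e_gt0.
have er : expR (- (M + e)) < expR (- M) by rewrite ltr_expR; lra.
have [[s1 sec1] _] := u_sections uM (expR_gt0 _) er.
rewrite -EFinD -[M + e]opprK -[- (M + e)]expRK.
apply: (u_le (expR_gt0 _) sec1 (s2 := s2)).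
have wsub : Rball w (expR (- (M + e))) `<=` Rball (p2 y0) r1.
  have -> : r1 = 2 * r0 by rewrite /r0; field.
  have er0 : expR (- (M + e)) <= r0 by rewrite -[r0]lnK ?posrE// ler_expR; lra.
  by move=> v /(Rball_le (expR_gt0 _) er0); exact: Rball_half.
rewrite pw; split; first by rewrite pw.
- by move=> v /wsub; exact: ps2.
- by move=> v /wsub; exact: cs2.
Qed.

(** On a small complex circle around a point of the segment, [flat] bounds [u] by its truncated
    value at the real part, so the mean value inequality constrains a function of one real
    variable. *)
Lemma u_segment_le (c r0 : R) (s2 : 'rV[R]_n -> A2) (y0 : A2) (s : R -> A1) (a v : 'rV[R]_n) (M : R) :
  0 < r0 -> lsection p2 (Rball (p2 y0) r0) y0 s2 ->
  (forall (x : A1) (w : 'rV[R]_n) (M : R), Rball (p2 y0) r0 w -> c <= M -> (u x y0 <= M%:E)%E ->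
    (u x (s2 w) <= M%:E)%E) ->
  continuous s -> (forall t, 0 <= t <= 1 -> p1 (s t) = a + t *: v) ->
  c <= M -> (u (s 0%R) y0 <= M%:E)%E -> (u (s 1%R) y0 <= M%:E)%E ->
  forall t, 0 <= t <= 1 -> (u (s t) y0 <= M%:E)%E.
Proof.
move=> r00 sec2 flat cs ps cM u0 u1 t1 /andP[t10 t11].
pose K t := fine (maxe (u (s t) y0) M%:E).
have KE t : (K t)%:E = maxe (u (s t) y0) M%:E by exact: fine_maxK.
have uK t : (u (s t) y0 <= (K t)%:E)%E by rewrite KE le_max lexx.
have MK t : M <= K t by rewrite -lee_fin KE le_max lexx orbT.
have cK : continuous K.
  apply: continuous_fine_max => //.
  by move=> t; apply: (@continuous_comp _ _ _ s (u^~ y0)); [exact: cs|exact: u_cont].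
have K0 : K 0 = M by apply/EFin_inj; rewrite KE max_r.
have K1 : K 1 = M by apply/EFin_inj; rewrite KE max_r.
apply: (le_trans (uK t1)); rewrite lee_fin leNgt; apply/negP => Kt1.
(* At a maximum point [t0] of [K t + eta * t ^+ 2], the mean of [u] over a small
   circle is smaller than [K t0] by at least half of [eta * e ^+ 2]. *)
pose eta := (K t1 - M) / 2; have eta0 : 0 < eta by rewrite /eta; lra.
have [t0 + t0max] : exists2 t0, t0 \in `[0, 1]%R & forall t, t \in `[0, 1]%R ->
    K t + eta * t ^+ 2 <= K t0 + eta * t0 ^+ 2.
  apply: (@EVT_max R (fun t => K t + eta * t ^+ 2)).
    exact: ler01.
  apply: continuous_subspaceT => t; apply: cvgD; first exact: cK.
  by apply: cvgM; [exact: cvg_cst|exact: exprn_continuous].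
rewrite in_itv/= => /andP[t00 t01].
have := t0max t1; rewrite in_itv/= t10 t11 => /(_ erefl) h1.
have t02 : t0 ^+ 2 <= 1 by rewrite expr_le1.
(* Since [t0 ^+ 2 <= 1], maximality gives [K t0 >= K t1 - eta = M + eta]. Hence [t0] is interior and
   the truncation is inactive there. *)
have Kt0 : M < K t0.
  have := sqr_ge0 t1; rewrite /eta in eta0 h1 *; nra.
have {}t00 : 0 < t0.
  rewrite lt_neqAle t00 andbT; apply/eqP => t0E; move: Kt0; rewrite -t0E K0 ltxx.
  by [].
have {}t01 : t0 < 1.
  rewrite lt_neqAle t01 andbT; apply/eqP => t0E; move: Kt0; rewrite t0E K1 ltxx.
  by [].
have ut0 : u (s t0) y0 = (K t0)%:E.
  rewrite KE; apply/esym; rewrite max_l//; apply/ltW; rewrite ltNge; apply/negP => uM.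
  by move: Kt0; rewrite -lte_fin KE max_r// ltxx.
pose r := Num.min r0 (expR (- K t0) / 2).
have rpos : 0 < r by rewrite /r lt_min r00/= divr_gt0// expR_gt0.
have r_r0 : r <= r0 by rewrite /r ge_min lexx.
have [[s1 sec1] _] := u_sections (uK t0) rpos (ltac:(
  rewrite /r gt_min; apply/orP; right; have := expR_gt0 (- K t0); lra)).
have sec2r := lsection_sub (@Rball_le _ _ (p2 y0) _ _ rpos r_r0) sec2.
have : \forall t \near t0, s1 (p1 (s t)) = s t.
  have oN := lsection_image_open lp (@open_Rball _ _ _ _) sec1.
  have : \forall t \near t0, Rball (p1 (s t0)) r (p1 (s t)) /\ s1 (p1 (s t)) = s t.
    apply: (cs t0 [set z | Rball (p1 (s t0)) r (p1 z) /\ s1 (p1 z) = z]).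
    apply: open_nbhs_nbhs; split=> //; split; first exact: Rball_center.
    by case: sec1.
  by apply: filterS => t [].
move=> /nbhs_ballP[d /= d0 s1d].
pose q := sqn v; have q0 : 0 <= q by exact: sqn_ge0.
(* The bounds keep the circle over the image of [s1] ([d]), its real parts in [[0, 1]] ([t0],
   [1 - t0]), and [e *: v] in the [r]-ball, as [q <= (1 + q) ^+ 2]. *)
pose e := Num.min (Num.min d t0) (Num.min (1 - t0) (r / (1 + q))) / 2.
have m0 : 0 < Num.min (Num.min d t0) (Num.min (1 - t0) (r / (1 + q))).
  by rewrite !lt_min d0 t00 subr_gt0 t01 divr_gt0//; lra.
have : e < Num.min (Num.min d t0) (Num.min (1 - t0) (r / (1 + q))).
  by rewrite /e; lra.
have e0 : 0 < e by rewrite divr_gt0.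
rewrite !lt_min => /andP[/andP[ed et0] /andP[et1 eq]].
have vr : sqn (e *: v) < r ^+ 2.
  rewrite sqnZ -/q; rewrite ltr_pdivlMr in eq; last lra.
  have : (e * (1 + q)) ^+ 2 < r ^+ 2 by rewrite ltr_pXn2r// nnegrE; nra.
  apply: le_lt_trans; have := sqr_ge0 e; nra.
have := u_mean rpos sec1 sec2r vr.
rewrite ut0 leNgt => /negP; apply.
(* The coefficients come from expanding [eta * (t0 ^+ 2 - tau ^+ 2)] with [tau = t0 + e * cos t]. *)
apply: le_lt_trans (circle_mean_le (m := K t0) (a := 2 * eta * t0 * e)
  (b := eta * e ^+ 2) _) _; last first.
  have : 0 < eta * e ^+ 2 by rewrite mulr_gt0// exprn_gt0.
  by rewrite lte_fin; lra.
move=> t.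
have cos1 := cos_le1 t; have cosN1 := cos_geN1 t.
pose tau := t0 + e * cos t.
have tau01 : 0 <= tau <= 1 by rewrite /tau; nra.
have -> : p1 (s t0) + cos t *: (e *: v) = p1 (s tau).
  by rewrite !ps// ?ltW// scalerA /tau scalerDl addrA [cos t * e]mulrC.
rewrite s1d; last first.
  rewrite -ball_normE /= /tau opprD addrA subrr add0r normrN normrM.
  rewrite (ger0_norm (ltW e0)); apply: le_lt_trans ed.
  by rewrite ler_piMr ?(ltW e0)// ler_norml cosN1 cos1.
have sin1 : sin t ^+ 2 <= 1.
  by have := cos2Dsin2 t; have := sqr_ge0 (cos t); lra.
have Ktau : K tau <= K t0 - 2 * eta * t0 * e * cos t - eta * e ^+ 2 * cos t ^+ 2.
  have := t0max tau; rewrite in_itv/= tau01 => /(_ erefl); rewrite /tau.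
  nra.
rewrite -lee_fin in Ktau; apply: le_trans Ktau.
apply: flat (uK tau); last by rewrite (le_trans cM).
apply: Rball_le rpos r_r0 _ _; rewrite /Rball/= addrAC subrr add0r sqnZ.
by apply: le_lt_trans vr; rewrite exprMn k1 mul1r ler_piMl ?sqn_ge0.
Qed.

(** The bound [M] holds at [x0] and on [N], so the maximum principle spreads it along every lift
    ending in [N]; sections of one radius [r] then exist all along, and the endpoint can move within
    [N]. *)
Lemma segment_lifts_locally (x0 : A1) (y0 : A2) (x : A1) :
  exists2 N : set A1, nbhs x N & forall x1 x2, N x1 -> N x2 ->
    segment_lifts p1 x0 x1 -> segment_lifts p1 x0 x2.
Proof.
have [c [r0 [s2 [r00 sec2 flat]]]] := u_flat x0 y0.
have [M0 uM0] := u_real x0 y0; have [M1 uM1] := u_real x y0.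
(* [M1 + 1] makes the bound at [x] strict, hence valid near [x]; [c] is the threshold of [flat]. *)
pose M := Num.max c (Num.max M0 (M1 + 1)).
have [cM M0M M1M] : [/\ c <= M, M0 <= M & M1 < M].
  by rewrite /M !le_max !lt_max !lexx ltrDl ltr01 !orbT.
pose r := expR (- M) / 2; have eM := expR_gt0 (- M).
have rpos : 0 < r by rewrite /r; lra.
have rM : r < expR (- M) by rewrite /r; lra.
have xM : (u x y0 < M%:E)%E by rewrite (le_lt_trans uM1)// lte_fin.
have [[sx secx] _] := u_sections (ltW xM) rpos rM.
have half0 : 0 < r / 2 by lra.
have subB : Rball (p1 x) (r / 2) `<=` Rball (p1 x) r by apply: Rball_le => //; lra.
(* Radius [r / 2] puts the projections of any two points of [N] within [r] of each other. *)
exists ([set z | (u z y0 < M%:E)%E] `&`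
  [set z | Rball (p1 x) (r / 2) (p1 z) /\ sx (p1 z) = z]).
  apply: filterI.
    have : nbhs (u x y0) [set e | (e < M%:E)%E].
      by apply: open_nbhs_nbhs; split => //; exact: open_ereal_lt_ereal.
    exact: (@u_cont y0 x).
  apply: open_nbhs_nbhs; split.
    exact: lsection_image_open lp (@open_Rball _ _ _ _) (lsection_sub subB secx).
  by split; [exact: Rball_center|case: secx].
move=> x1 x2 [ux1 [Bx1 sx1]] [_ [Bx2 sx2]] [s [cs s0 s1 ps]].
have us t : 0 <= t <= 1 -> (u (s t) y0 <= M%:E)%E.
  apply: (u_segment_le r00 sec2 flat cs ps cM).
    by rewrite s0 (le_trans uM0)// lee_fin.
  by rewrite s1 ltW.
have [[sx' secx'] _] := u_sections (ltW ux1) rpos rM.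
have B12 : Rball (p1 x1) r (p1 x2).
  rewrite (_ : r = 2 * (r / 2)); last by field.
  exact: Rball_half (Rball_sym Bx1) _ Bx2.
apply: (segment_lifts_extend hA lp cs s0 s1 ps rpos _ secx' B12).
  by move=> t t01; have [] := u_sections (us t t01) rpos rM.
rewrite -[RHS]sx2.
apply: (Rball_agree hA lp secx' secx (Rball_center _ rpos) (subB _ Bx1)) => //.
  by rewrite sx1; case: secx'.
exact: subB.
Qed.

(** The neighbourhood [N] transfers lifts from its centre to its points and back, so the set of
    endpoints is both open and closed. *)
Lemma segment_lifts_all (y0 : A2) (x0 x1 : A1) : segment_lifts p1 x0 x1.
Proof.
suff -> : segment_lifts p1 x0 = setT by [].
apply: cA.
- by exists x0; exact: segment_lifts_refl.
- exists (segment_lifts p1 x0); last by rewrite setTI.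
  rewrite openE => x slx; have [N Nx NP] := segment_lifts_locally x0 y0 x.
  have Nxx := nbhs_singleton Nx.
  by apply: filterS Nx => z Nz; exact: NP slx.
- exists (segment_lifts p1 x0); last by rewrite setTI.
  move=> x clx; have [N Nx NP] := segment_lifts_locally x0 y0 x.
  have [z [slz Nz]] := clx _ Nx.
  by apply: NP slz => //; exact: (nbhs_singleton Nx).
Qed.
End convexity.

(** * Application to the tube *)

Lemma sqnZ_le (R : realType) (n : nat) (v : 'rV[R]_n) (l1 l2 : R) :
  l1 ^+ 2 + l2 ^+ 2 <= 1 -> sqn (l1 *: v) <= sqn v.
Proof.
move=> l12; rewrite sqnZ; apply: ler_piMl; first exact: sqn_ge0.
have := sqr_ge0 l2; lra.
Qed.

(** The product of the images of [s1] and [s2] serves as the open set on which the projection is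
    injective; the hypothesis on [b] keeps the closed disc in the product of the two balls. *)
Lemma neglog_bdist_disc_mean (R : realType) (n : nat) (A1 A2 : topologicalType)
    (p1 : A1 -> 'rV[R]_n) (p2 : A2 -> 'rV[R]_n) (x : A1) (y : A2) (r : R)
    (s1 : 'rV[R]_n -> A1) (s2 : 'rV[R]_n -> A2) (b : Cn R n) :
  local_homeo p1 -> local_homeo p2 ->
  plurisubharmonic (tube_proj p1 p2) (neglog_bdist (tube_proj p1 p2)) ->
  lsection p1 (Rball (p1 x) r) x s1 -> lsection p2 (Rball (p2 y) r) y s2 ->
  0 < r ->
  (forall l1 l2, l1 ^+ 2 + l2 ^+ 2 <= 1 ->
     sqn (l1 *: b.1 - l2 *: b.2) < r ^+ 2 /\ sqn (l2 *: b.1 + l1 *: b.2) < r ^+ 2) ->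
  (neglog_bdist (tube_proj p1 p2) (x, y) <= ((2 * pi)^-1)%R%:E *
    \int[@lebesgue_measure R]_(t in `[0%R, (2 * pi)%R])
      neglog_bdist (tube_proj p1 p2)
        (s1 (p1 x + (cos t *: b.1 - sin t *: b.2))%R,
         s2 (p2 y + (sin t *: b.1 + cos t *: b.2))%R))%E.
Proof.
move=> l1 l2 [_ [_ mean]] sec1 sec2 r0 bB.
pose N1 := [set z | Rball (p1 x) r (p1 z) /\ s1 (p1 z) = z].
pose N2 := [set z | Rball (p2 y) r (p2 z) /\ s2 (p2 z) = z].
have oN1 : open N1 := lsection_image_open l1 (@open_Rball _ _ _ _) sec1.
have oN2 : open N2 := lsection_image_open l2 (@open_Rball _ _ _ _) sec2.
have N1s v : Rball (p1 x) r v -> N1 (s1 v).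
  by case: sec1 => _ f1 _ Bv; split; rewrite f1.
have N2s v : Rball (p2 y) r v -> N2 (s2 v).
  by case: sec2 => _ f2 _ Bv; split; rewrite f2.
have line k1 k2 : k1 ^+ 2 + k2 ^+ 2 <= 1 ->
    Rball (p1 x) r (p1 x + (k1 *: b.1 - k2 *: b.2)) /\
    Rball (p2 y) r (p2 y + (k2 *: b.1 + k1 *: b.2)).
  by move=> /bB; rewrite /Rball/= ![_ + (_ + _) - _]addrAC !subrr !add0r.
have circ t : cos t ^+ 2 + sin t ^+ 2 <= 1 :> R by rewrite cos2Dsin2.
apply: (mean (N1 `*` N2) (x, y) b (fun t =>
  (s1 (p1 x + (cos t *: b.1 - sin t *: b.2)),
   s2 (p2 y + (sin t *: b.1 + cos t *: b.2))))).
- rewrite openE => -[z w] [/= Nz Nw].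
  by exists (N1, N2) => //; split; exact: open_nbhs_nbhs.
- move=> [z w] [z' w']; rewrite !inE => -[[_ /= zE] [_ /= wE]] [[_ /= zE'] [_ /= wE']].
  by move=> [pz pw]; rewrite -zE -wE pz pw zE' wE'.
- by split; (split; first exact: Rball_center); [case: sec1|case: sec2].
- move=> k1 k2 /line[B1 B2].
  exists (s1 (p1 x + (k1 *: b.1 - k2 *: b.2)), s2 (p2 y + (k2 *: b.1 + k1 *: b.2))).
    by split; [exact: N1s|exact: N2s].
  by rewrite /tube_proj /line_pt/=; case: sec1 => _ -> // _; case: sec2 => _ -> // _.
- move=> t; have [B1 B2] := line _ _ (circ t).
  split; first by split; [exact: N1s|exact: N2s].
  by rewrite /tube_proj /circ_pt/=; case: sec1 => _ -> // _; case: sec2 => _ -> // _.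
Qed.

Lemma unramified_real_domain_convex (R : realType) (n : nat) (A : topologicalType)
    (p : A -> 'rV[R]_n) :
  unramified_real_domain p -> (forall x0 x1, segment_lifts p x0 x1) ->
  injective p /\
  [/\ open (p @` setT), connected (p @` setT) & convex_set (p @` setT)].
Proof.
move=> [hA cA A0 lp] sl; split.
  by move=> x0 x1; exact/segment_lifts_inj.
split.
- rewrite openE => _ [x _ <-]; have [W [oW Wx _ opW]] := lp.2 x.
  have : nbhs (p x) (p @` W) by apply: open_nbhs_nbhs; split; [exact: opW|exists x].
  by apply: filterS => _ [z _ <-]; exists z.
- apply: connected_continuous_connected => //.
  by apply: continuous_subspaceT; exact: lp.1.
- exact: segment_lifts_convex.
Qed.

Unset Implicit Arguments.
Theorem theorem1p2 (R : realType) (n : nat) (A1 A2 : topologicalType)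
    (p1 : A1 -> 'rV[R]_n) (p2 : A2 -> 'rV[R]_n) :
  unramified_real_domain p1 -> unramified_real_domain p2 ->
  pseudoconvex (tube_proj p1 p2) ->
  [/\ injective p1, injective p2,
      [/\ open (p1 @` setT), connected (p1 @` setT) & convex_set (p1 @` setT)] &
      [/\ open (p2 @` setT), connected (p2 @` setT) & convex_set (p2 @` setT)]].
Proof.
move=> D1 D2 [ucont psh].
have [h1 c1 [x0 _] l1] := D1; have [h2 c2 [y0 _] l2] := D2.
have ufin := psh.1.
pose u x y := neglog_bdist (tube_proj p1 p2) (x, y).
have cx y : continuous (u^~ y).
  move=> x; apply: (@continuous_comp _ _ _ (fun x => (x, y))); last exact: ucont.
  by apply: continuous_pair; [exact: cvg_id|exact: cst_continuous].
have cy x : continuous (u x).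
  move=> y; apply: (@continuous_comp _ _ _ (fun y => (x, y))); last exact: ucont.
  by apply: continuous_pair; [exact: cst_continuous|exact: cvg_id].
have sl1 x x' : segment_lifts p1 x x'.
  apply: (@segment_lifts_all R n A1 A2 p1 p2 u 1) => //.
  - by rewrite expr1n.
  - by move=> a b; exact: ufin.
  - by move=> a b M r uM r0 rM; exact: (lsection_of_neglog l1 l2 uM r0 rM).
  - by move=> a b r s1 s2 r0 sec1 sec2; exact: neglog_bdist_le sec1 sec2.
  - move=> a b r s1 s2 v r0 sec1 sec2 vr.
    (* Along a real vector the circle moves [x] by [cos t *: v] and [y] by [sin t *: v], so
       [k = 1]. *)
    have := neglog_bdist_disc_mean (b := (v, 0)) l1 l2 psh sec1 sec2 r0.
    rewrite /=; under eq_integral do rewrite scaler0 subr0 scaler0 addr0 -[sin _]mul1r.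
    apply=> k1 k2 k12; rewrite !scaler0 subr0 addr0; split.
      exact: le_lt_trans (sqnZ_le _ k12) vr.
    by rewrite addrC in k12; exact: le_lt_trans (sqnZ_le _ k12) vr.
have sl2 y y' : segment_lifts p2 y y'.
  apply: (@segment_lifts_all R n A2 A1 p2 p1 (fun y x => u x y) (-1)) => //.
  - by rewrite sqrrN expr1n.
  - by move=> b a; exact: ufin.
  - by move=> b a M r uM r0 rM; have [] := lsection_of_neglog l1 l2 uM r0 rM.
  - by move=> b a r s2 s1 r0 sec2 sec1; exact: neglog_bdist_le sec1 sec2.
  - move=> b a r s2 s1 v r0 sec2 sec1 vr.
    (* Along [i v] the circle moves [y] by [cos t *: v] and [x] by [- sin t *: v], so [k = -1]. *)
    have := neglog_bdist_disc_mean (b := (0, v)) l1 l2 psh sec1 sec2 r0.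
    rewrite /=; under eq_integral do rewrite !scaler0 sub0r add0r -scaleNr -mulN1r.
    apply=> k1 k2 k12; rewrite !scaler0 sub0r add0r sqnN; split; last first.
      exact: le_lt_trans (sqnZ_le _ k12) vr.
    by rewrite addrC in k12; exact: le_lt_trans (sqnZ_le _ k12) vr.
have [i1 r1] := unramified_real_domain_convex D1 sl1.
have [i2 r2] := unramified_real_domain_convex D2 sl2.
by split.
Qed.
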